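(* Let $x_1,\dots,x_m$ be independent real random variables, $x_i$ taking values in a bounded interval $I_i$, and let $K_u(\mathbf x)$ be a polynomial in the $x_i$ and their positive and negative parts $x_i^+=\max\{x_i,0\}$, $x_i^-=\max\{-x_i,0\}$. Let $b\ge1$ and let $n\ge2$ be an even integer. For each $i$, partition $I_i$ into pairwise disjoint sub-ranges $I_{i,1},\dots,I_{i,b}$ with $\bigcup_j I_{i,j}=I_i$ and weights $w_{i,j}=\mathbb P[x_i\in I_{i,j}]>0$. For each multi-index $\mathbf i=(i_1,\dots,i_m)\in\{1,\dots,b\}^m$ let $B_{\mathbf i}=I_{1,i_1}\times\cdots\times I_{m,i_m}$ and $W_{\mathbf i}=\prod_{j=1}^m w_{j,i_j}$; let $\mu_{\mathbf i}=\mathbb E[K_u(\mathbf x)\mid\mathbf x\in B_{\mathbf i}]$; set $\mathrm{flag}_{u,B_{\mathbf i}}=\mathbb E[(K_u(\mathbf x)-\mu_{\mathbf i})^n\mid\mathbf x\in B_{\mathbf i}]/\mu_{\mathbf i}^n$ if $\mu_{\mathbf i}<0$ and $\mathrm{flag}_{u,B_{\mathbf i}}=1$ otherwise, and then replace $\mathrm{flag}_{u,B_{\mathbf i}}$ by $1$ if it exceeds $1$. Let $\mathrm{flag}_u=\sum_{\mathbf i\in\{1,\dots,b\}^m}W_{\mathbf i}\cdot\mathrm{flag}_{u,B_{\mathbf i}}$. Then $$\mathbb P[K_u(\mathbf x)\ge0]\le\mathrm{flag}_u.$$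
   Context: $\mathbb P$ and $\mathbb E$ denote probability and expectation; for an event $E$ with $\mathbb P[E]>0$, $\mathbb E[X\mid E]=\left(\int_E X\,\mathrm d\mathbb P\right)/\mathbb P[E]$. *)

(* Defs.v *)
From HB Require Import structures.
From mathcomp Require Import all_boot all_order all_algebra.
From mathcomp Require Import all_classical all_reals all_analysis.
(* Not imported: its notations clash with those of mathcomp-analysis. *)
From mathcomp Require mpoly.

Set Implicit Arguments.
Unset Strict Implicit.
Unset Printing Implicit Defensive.

Import Order.TTheory GRing.Theory Num.Theory.
Import numFieldNormedType.Exports.

Local Open Scope classical_set_scope.
Local Open Scope ring_scope.

Section probability_notions.
Context {d : measure_display} {T : measurableType d} {R : realType}.
Variable P : probability T R.

Definition mutually_independent (m : nat) (x : 'I_m -> {RV P >-> R}) : Prop :=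
  forall (S : {set 'I_m}) (A : 'I_m -> set R),
    (forall i, measurable (A i)) ->
    P [set w | forall i, i \in S -> A i (x i w)] =
    (\prod_(i in S) P (x i @^-1` A i))%E.

(* Meaningful when P E > 0 and X is integrable on E. *)
Definition cond_expectation (X : T -> R) (E : set T) : R :=
  (\int[P]_(w in E) X w)%R / fine (P E).

Definition random_vector (m : nat) (x : 'I_m -> {RV P >-> R}) :
    T -> ('I_m -> R) :=
  fun w i => x i w.

End probability_notions.

(* The 3m coordinates (v_i), (v_i^+), (v_i^-), in this order. *)
Definition with_parts (R : realType) (m : nat) (v : 'I_m -> R)
    (k : 'I_(m + (m + m))) : R :=
  match fintype.split k with
  | inl i => v i
  | inr k' =>
      match fintype.split k' with
      | inl i => Num.max (v i) 0
      | inr i => Num.max (- v i) 0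
      end
  end.

Definition eval_parts (R : realType) (m : nat)
    (K : mpoly.mpoly (m + (m + m)) R) (v : 'I_m -> R) : R :=
  mpoly.meval (with_parts v) K.

Section flags.
Context {d : measure_display} {T : measurableType d} {R : realType}.
Variables (P : probability T R) (m b : nat) (x : 'I_m -> {RV P >-> R}).
Variables (K : mpoly.mpoly (m + (m + m)) R) (n : nat).
Variable J : 'I_m -> 'I_b -> set R.

Definition weight (i : 'I_m) (j : 'I_b) : R := fine (P (x i @^-1` J i j)).

Definition box (i : {ffun 'I_m -> 'I_b}) : set ('I_m -> R) :=
  [set v | forall k, J k (i k) (v k)].

Definition box_weight (i : {ffun 'I_m -> 'I_b}) : R :=
  \prod_(k < m) weight k (i k).

Definition box_event (i : {ffun 'I_m -> 'I_b}) : set T :=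
  random_vector x @^-1` box i.

Definition box_mean (i : {ffun 'I_m -> 'I_b}) : R :=
  cond_expectation P (fun w => eval_parts K (random_vector x w)) (box_event i).

Definition raw_box_flag (i : {ffun 'I_m -> 'I_b}) : R :=
  if box_mean i < 0 then
    cond_expectation P
      (fun w => (eval_parts K (random_vector x w) - box_mean i) ^+ n)
      (box_event i) / box_mean i ^+ n
  else 1.

Definition box_flag (i : {ffun 'I_m -> 'I_b}) : R :=
  if 1 < raw_box_flag i then 1 else raw_box_flag i.

Definition flag : R :=
  \sum_(i : {ffun 'I_m -> 'I_b}) box_weight i * box_flag i.

End flags.

(* Main.v *)
(** On each box, [K >= 0] together with a negative conditional mean [mu] forces
    [(K - mu)^n >= mu^n > 0] ([n] even), so Markov's inequality applied to the
    [n]-th central moment bounds the probability of [K >= 0] within the box by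
    its weight times its flag; the bound by the weight itself is trivial.
    Independence identifies the weight with the probability of the box, and
    subadditivity over the boxes, which cover the sample space, concludes.
    Boundedness of the [I i] makes the central moments finite. *)
Require Import Defs.
From HB Require Import structures.
From mathcomp Require Import all_boot all_order all_algebra.
From mathcomp Require Import all_classical all_reals all_analysis.
From mathcomp Require Import measurable_realfun.
From mathcomp Require mpoly.

Import Order.TTheory GRing.Theory Num.Theory.
Import numFieldNormedType.Exports.

Local Open Scope classical_set_scope.
Local Open Scope ring_scope.

(** The triangle inequality over the monomials. The bound involves [M] but not [v], so a polynomial
    in uniformly bounded coordinates is uniformly bounded. *)
Lemma normr_meval_le (R : realType) (k : nat) (p : mpoly.mpoly k R)
    (M v : 'I_k -> R) :
  (forall i, `|v i| <= M i) ->
  `|mpoly.meval v p| <=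
  \sum_(e <- mpoly.msupp p)
    `|mpoly.mcoeff e p| * \prod_i M i ^+ mpoly.fun_of_multinom e i.
Proof.
move=> vM; rewrite mpoly.mevalE (le_trans (ler_norm_sum _ _ _))//.
apply: ler_sum => e _; rewrite normrM ler_wpM2l// normr_prod.
apply: ler_prod => i _.
by rewrite normr_ge0 normrX lerXn2r ?nnegrE ?(le_trans _ (vM i)).
Qed.

Lemma measurable_meval {d : measure_display} {T : measurableType d}
    {R : realType} (k : nat) (p : mpoly.mpoly k R) (v : T -> 'I_k -> R) :
  (forall i, measurable_fun setT (fun w => v w i)) ->
  measurable_fun setT (fun w => mpoly.meval (v w) p).
Proof.
move=> mv; under eq_fun do rewrite mpoly.mevalE.
apply: measurable_sum => e; apply: measurable_funM => //.
by apply: measurable_prod => i _; exact: measurable_funX.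
Qed.

Lemma measurable_with_parts {d : measure_display} {T : measurableType d}
    {R : realType} (m : nat) (v : T -> 'I_m -> R) k :
  (forall i, measurable_fun setT (fun w => v w i)) ->
  measurable_fun setT (fun w => with_parts (v w) k).
Proof.
move=> mv; rewrite /with_parts; case: (fintype.split k) => [i|k']; first exact: mv.
case: (fintype.split k') => i.
  by apply: measurable_maxr; [exact: mv|exact: measurable_cst].
apply: measurable_maxr; last exact: measurable_cst.
exact: measurableT_comp (mv i).
Qed.

(** Each of the three kinds of coordinate is [v i], [- v i] or 0. The index is chosen before [v], so
    one bound on coordinate [i] serves every sample point. *)
Lemma normr_with_parts_le (R : realType) (m : nat) k :
  exists i, forall v : 'I_m -> R, `|with_parts v k| <= `|v i|.
Proof.
rewrite /with_parts; case: (fintype.split k) => [i|k']; first by exists i.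
case: (fintype.split k') => i; exists i => v; rewrite maxEle;
  by case: ifP => _; rewrite ?normr0 ?normrN.
Qed.

Section even_moments.
Context {d : measure_display} {T : measurableType d} {R : realType}.
Variable P : probability T R.

(** Markov's inequality with the threshold [c ^+ n]: where [f] is nonnegative, [f w - c] is at least
    [- c], which is nonnegative, and even powers preserve this. The product form avoids dividing by
    [c ^+ n]. *)
Lemma even_moment_markov (f : T -> R) (E : set T) (M c : R) (n : nat) :
  measurable E -> measurable_fun setT f -> (forall w, `|f w| <= M) ->
  ~~ odd n -> c <= 0 ->
  c ^+ n * fine (P (E `&` [set w | 0 <= f w])) <=
  (\int[P]_(w in E) ((f w - c) ^+ n))%R.
Proof.
move=> mE mf fM n_even c0.
pose g w := (f w - c) ^+ n.
have mg D : measurable_fun D g.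
  apply: (@measurable_funS _ _ _ _ setT) => //.
  by apply: measurable_funX; exact: measurable_funB.
have g0 w : 0 <= g w by exact: exprn_even_ge0.
have mf0 : measurable [set w | 0 <= f w].
  by rewrite -[X in measurable X]setTI; exact: measurable_fun_le.
have mEf : measurable (E `&` [set w | 0 <= f w]) by exact: measurableI.
have ig D : measurable D -> P.-integrable D (EFin \o g).
  move=> mD; apply: measurable_bounded_integrable => //.
    by rewrite (le_lt_trans (probability_le1 _ _)) ?ltry.
  exists ((M + `|c|) ^+ n); split => [|N ltN w _ /=]; first exact: num_real.
  rewrite (le_trans _ (ltW ltN))// normrX lerXn2r ?nnegrE//.
    by rewrite (le_trans (normr_ge0 (f w)))// (le_trans (fM w))// lerDl.
  by rewrite (le_trans (ler_normB _ _))// lerD2r.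
(* The left side becomes the integral of the constant [c ^+ n] over the part of [E] where [f] is
   nonnegative; the integrand is then enlarged to [g], and afterwards the domain to [E]. *)
rewrite -Rintegral_cst//.
apply: (@le_trans _ _ (\int[P]_(w in E `&` [set w | 0 <= f w]) g w)).
  apply: le_Rintegral => //.
  - apply: measurable_bounded_integrable => //.
      by rewrite (le_lt_trans (probability_le1 _ _)) ?ltry.
    by exists `|c ^+ n|; split => [|N /ltW ltN w _//]; exact: num_real.
  - exact: ig.
  (* As [n] is even, [c ^+ n] equals [(- c) ^+ n], so only the nonnegative bases [- c] and [f w - c]
     are compared. *)
  - move=> w [_ /= fw0]; rewrite /g -(normr_idP (exprn_even_ge0 c n_even)).
    rewrite normrX ler0_norm// lerXn2r ?nnegrE ?oppr_ge0 ?subr_ge0 ?(le_trans c0)//.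
    by rewrite lerDr.
rewrite /Rintegral fine_le//.
- exact: integrable_fin_num (ig _ mEf).
- exact: integrable_fin_num (ig _ mE).
apply: ge0_subset_integral => //; first exact/measurable_EFinP/mg.
by move=> w _; rewrite lee_fin.
Qed.

End even_moments.

Section box_bounds.
Context {d : measure_display} {T : measurableType d} {R : realType}.
Variables (P : probability T R) (m b : nat) (x : 'I_m -> {RV P >-> R}).
Variable K : mpoly.mpoly (m + (m + m)) R.
Variable J : 'I_m -> 'I_b -> set R.
Hypothesis J_meas : forall i j, measurable (J i j).

Local Notation Kx := (fun w => eval_parts K (random_vector x w)).

Lemma measurable_eval_parts : measurable_fun setT Kx.
Proof. by apply: measurable_meval => k; apply: measurable_with_parts => i. Qed.

Lemma measurable_eval_parts_ge0 : measurable [set w | 0 <= Kx w].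
Proof.
rewrite -[X in measurable X]setTI; apply: measurable_fun_le => //.
exact: measurable_eval_parts.
Qed.

Lemma bounded_eval_parts (I : 'I_m -> set R) :
  (forall i, bounded_set (I i)) -> (forall i w, I i (x i w)) ->
  exists M : R, forall w, `|Kx w| <= M.
Proof.
move=> I_bounded x_in_I.
have /choice[M xM] : forall k : 'I_(m + (m + m)),
    exists M, forall w, `|with_parts (random_vector x w) k| <= M.
  move=> k; have [i vi] := @normr_with_parts_le R m k.
  (* Boundedness provides a bound only by numbers strictly above [M], hence [M + 1]. *)
  have [M [_ IM]] := I_bounded i; exists (M + 1) => w.
  by rewrite (le_trans (vi _))//; apply: IM (x_in_I i w); rewrite ltrDl.
(* Unification supplies the witness: the monomial bound at the coordinate bounds [M]. *)
by eexists => w; apply: normr_meval_le => k; exact: xM.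
Qed.

Lemma measurable_box_event i : measurable (box_event x J i).
Proof.
rewrite (_ : box_event x J i = \bigcap_(k in [set: 'I_m]) x k @^-1` J k (i k)).
  apply: fin_bigcap_measurable => // k _.
  by rewrite -[X in measurable X]setTI; exact: measurable_funP.
by apply/seteqP; split => w /= h k; [move=> _; exact: h|exact: h].
Qed.

Lemma probability_box_event i :
  mutually_independent x -> P (box_event x J i) = (box_weight x J i)%:E.
Proof.
move=> x_indep; have := x_indep [set: 'I_m]%SET (fun k => J k (i k)).
rewrite (_ : [set w | _] = box_event x J i); last first.
  by apply/seteqP; split => w /= h k; [apply: h; rewrite inE|move=> _; exact: h].
move=> -> //; rewrite /box_weight -prodEFin.
apply: eq_big => k; rewrite ?inE// => _.
rewrite /weight fineK// fin_num_measure//.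
by rewrite -[X in measurable X]setTI; exact: measurable_funP.
Qed.

Lemma probability_box_flag i (n : nat) (M : R) :
  mutually_independent x -> (forall w, `|Kx w| <= M) -> ~~ odd n ->
  0 < box_weight x J i ->
  (P (box_event x J i `&` [set w | (0 <= Kx w)%R]) <=
   (box_weight x J i * box_flag x K n J i)%R%:E)%E.
Proof.
move=> x_indep KM n_even W0.
have mE := measurable_box_event i.
have mA : measurable [set w | 0 <= Kx w] by exact: measurable_eval_parts_ge0.
(* Settles both cases where the flag is 1: truncation and a nonnegative mean. *)
have trivial_bound : (P (box_event x J i `&` [set w | (0 <= Kx w)%R]) <=
    (box_weight x J i * 1)%R%:E)%E.
  rewrite mulr1 -probability_box_event// le_measure ?inE//.
  exact: measurableI.
rewrite /box_flag; case: ltP => // _; rewrite /raw_box_flag; case: ltP => // mu0.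
rewrite /cond_expectation probability_box_event//= -[leLHS]fineK; last first.
  by rewrite fin_num_measure//; exact: measurableI.
(* The weight cancels the denominator of the conditional expectation, and the positive [n]-th power
   of the mean moves to the left. *)
rewrite lee_fin mulrA [X in X / _]mulrC divfK ?gt_eqF// ler_pdivlMr; last first.
  by rewrite exprn_even_gt0// (lt_eqF mu0) orbT.
rewrite mulrC; apply: even_moment_markov KM n_even (ltW mu0) => //.
exact: measurable_eval_parts.
Qed.

End box_bounds.

Theorem theorem4p8 (R : realType) (d : measure_display) (T : measurableType d)
    (P : probability T R) (m : nat) (x : 'I_m -> {RV P >-> R})
    (x_indep : mutually_independent x)
    (I : 'I_m -> set R)
    (I_itv : forall i, is_interval (I i))
    (I_bounded : forall i, bounded_set (I i))
    (x_in_I : forall i w, I i (x i w))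
    (K : mpoly.mpoly (m + (m + m)) R)
    (b : nat) (b_ge1 : (1 <= b)%N)
    (n : nat) (n_ge2 : (2 <= n)%N) (n_even : ~~ odd n)
    (J : 'I_m -> 'I_b -> set R)
    (J_meas : forall i j, measurable (J i j))
    (J_disj : forall i, trivIset setT (J i))
    (J_cover : forall i, \bigcup_j J i j = I i)
    (w_gt0 : forall i j, 0 < weight x J i j) :
  (P [set w | (0 <= eval_parts K (random_vector x w))%R]
     <= (flag x K n J)%:E)%E.
Proof.
have [M KM] := @bounded_eval_parts _ _ _ _ _ x K _ I_bounded x_in_I.
set A := [set w | _].
have mA : measurable A by exact: measurable_eval_parts_ge0.
have mEA i : measurable (box_event x J i `&` A).
  by apply: measurableI => //; exact: measurable_box_event.
have cover : A `<=` \bigcup_(i in [set` index_enum {ffun 'I_m -> 'I_b}])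
    (box_event x J i `&` A).
  (* Choosing in each coordinate a sub-range that contains [x k w] gives the multi-index of a box
     containing the sample. *)
  move=> w Aw; have /choice[i Ji] : forall k, exists j, J k j (x k w).
    by move=> k; have := x_in_I k w; rewrite -J_cover => -[j _ ?]; exists j.
  exists (finfun i); [exact: mem_index_enum|split] => // k.
  by rewrite /= ffunE; exact: Ji.
rewrite (le_trans (content_sub_fsum P _ _ _ cover))//.
rewrite -fsbig_seq ?index_enum_uniq// /flag -sumEFin.
apply: lee_sum => i _; apply: probability_box_flag KM n_even _ => //.
exact: prodr_gt0.
Qed.
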